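(* Let $(\mathbb{S},\Sigma)$ be a measurable space, $\{\mu^{(n)}\}_{n=1,2,\ldots}\subset\mathcal{M}(\mathbb{S})$, let $\mu$ be a measure on $\mathbb{S}$, and let $\{\tilde\mu,\tilde\mu^{(n)}\}_{n=1,2,\ldots}$ be a sequence of finite signed measures on $\mathbb{S}$. Assume that $\tilde\mu\ll\mu$ and $\tilde\mu^{(n)}\ll\mu^{(n)}$ for each $n=1,2,\ldots$. If the sequence $\{\mu^{(n)}\}_{n=1,2,\ldots}$ converges in total variation to $\mu$, then the inequality $$\liminf_{n\to\infty}\ \inf_{S\in\Sigma}\left(\tilde\mu^{(n)}(S)-\tilde\mu(S)\right)\ge 0$$ holds if and only if the following two statements hold: (i) for each $\varepsilon>0$ $$\mu\left(\left\{s\in\mathbb{S}: \frac{d\tilde\mu^{(n)}}{d\mu^{(n)}}(s)\le\frac{d\tilde\mu}{d\mu}(s)-\varepsilon\right\}\right)\to0\quad\text{as }n\to\infty,$$ and, therefore (as a consequence of this convergence), there exists a subsequence $\left\{\frac{d\tilde\mu^{(n_k)}}{d\mu^{(n_k)}}\right\}_{k=1,2,\ldots}$ of $\left\{\frac{d\tilde\mu^{(n)}}{d\mu^{(n)}}\right\}_{n=1,2,\ldots}$ such that $$\liminf_{k\to\infty}\frac{d\tilde\mu^{(n_k)}}{d\mu^{(n_k)}}(s)\ge\frac{d\tilde\mu}{d\mu}(s)\quad\text{for }\mu\text{-a.e. }s\in\mathbb{S};$$ (ii) the inequality $$\liminf_{K\to+\infty}\ \inf_{n=1,2,\ldots}\tilde\mu^{(n)}\left(\left\{s\in\mathbb{S}:\frac{d\tilde\mu^{(n)}}{d\mu^{(n)}}(s)\le-K\right\}\right)\ge0$$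 holds.
   Context: $\mathcal{M}(\mathbb{S})$ is the family of finite (nonnegative) measures on $(\mathbb{S},\Sigma)$. For $\mu\in\mathcal{M}(\mathbb{S})$ and a measure $\nu$ on $\mathbb{S}$, $\mathrm{dist}(\mu,\nu):=\sup\{|\int_{\mathbb{S}} g\,d\mu-\int_{\mathbb{S}} g\,d\nu| : g:\mathbb{S}\to[-1,1]\text{ measurable}\}$; finite measures $\mu^{(n)}$ converge in total variation to a measure $\mu$ if $\lim_{n\to\infty}\mathrm{dist}(\mu^{(n)},\mu)=0$ (then $\mu$ is automatically finite). $\frac{d\tilde\nu}{d\nu}$ denotes (a version of) the Radon–Nikodym derivative of a finite signed measure $\tilde\nu$ with respect to a finite measure $\nu$ with $\tilde\nu\ll\nu$. *)

(* Defs.v *)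
From HB Require Import structures.
From mathcomp Require Import all_boot all_order all_algebra.
From mathcomp Require Import all_classical all_reals all_analysis.

Set Implicit Arguments.
Unset Strict Implicit.
Unset Printing Implicit Defensive.

Import Order.TTheory GRing.Theory Num.Theory.
Import numFieldNormedType.Exports.

Local Open Scope classical_set_scope.
Local Open Scope ring_scope.
Local Open Scope ereal_scope.

(* For mu finite and nu infinite the value is +oo (take g = 1), so the convention
   +oo - +oo = -oo for the integral of a non-integrable g has no effect. *)
Definition tv_dist (d : measure_display) (T : measurableType d) (R : realType)
    (mu nu : {measure set T -> \bar R}) : \bar R :=
  ereal_sup [set `| \int[mu]_x (g x)%:E - \int[nu]_x (g x)%:E | | g in
    [set g : T -> R | measurable_fun [set: T] g /\
                      forall x, (-1 <= g x <= 1)%R]].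

(* f is a version of d(nu)/d(mu). Versions are not unique, and mu is not
   required to be sigma-finite as it is for the library's ['d nu '/d mu], which
   is one such version when both are defined. *)
Definition is_Radon_Nikodym (d : measure_display) (T : measurableType d)
    (R : realType) (nu : {charge set T -> \bar R})
    (mu : {measure set T -> \bar R}) (f : T -> \bar R) : Prop :=
  mu.-integrable [set: T] f /\
  forall A, measurable A -> nu A = \int[mu]_(x in A) f x.

Lemma Radon_Nikodym_is_version (d : measure_display) (T : measurableType d)
    (R : realType) (nu : {charge set T -> \bar R})
    (mu : {sigma_finite_measure set T -> \bar R}) :
  nu `<< mu -> is_Radon_Nikodym nu mu (Radon_Nikodym nu mu).
Proof.
move=> numu; split; first exact: Radon_Nikodym_integrable.
by move=> A; exact: Radon_Nikodym_integral.
Qed.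

(* Main.v *)
Require Import Defs.
From HB Require Import structures.
From mathcomp Require Import all_boot all_order all_algebra.
From mathcomp Require Import all_classical all_reals all_analysis.
From mathcomp Require Import measurable_realfun.
From mathcomp Require Import lra ring.

(** Both sides of the equivalence are first rewritten with epsilons: the liminf
of the infima over measurable sets is nonnegative iff [nu] is, up to any error
[e], an eventual minorant of [nu_ n] uniformly over measurable sets
([uniform_minorant]), and condition (ii) says that the sets where
[f_ n <= - K] carry almost no negative mass when [K] is large, uniformly in [n]
([vanishing_lower_tails]).

The difficulty is that the integrals of [f_ n] and [f] are taken against
different measures. Total variation only compares integrals of bounded
functions, so one works on sets [S] where [|f| <= M]. There, if [f_ n] lies
below [f - e] (or above it), then, with [delta] the total variation distance,
[nu_ n S] is compared with the integral of the bounded function [f - e] against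
[mu_ n], hence with [nu S - e * mu S] up to [(M + e) * delta]: these are
[charge_le_tv] and [charge_ge_tv]. What happens where [|f|] is large is
controlled by the integral of [|f|] over that region, which is small since [f]
is integrable ([integrable_tail]).

If [nu] is an eventual uniform minorant, applying this to the part of
[f_ n <= f - eps] where [|f| < M] gives
[nu S - o(1) <= nu_ n S <= nu S - eps * mu S + o(1)], so [mu S] is small: this is
the convergence in (i). Moreover the set [f_ n <= - K] is then, up to small
measure, inside [f <= 1 - K], so it is small for [mu], hence for [nu], hence
[nu_ n] is at least a small negative number on it; finitely many [n] are
handled separately by integrability of [f_ n].

Conversely, split a measurable set according to whether [|f| < M] and
[f_ n > f - eps], or not. On the first part the comparison applies. The second
part is small for [mu] and for [mu_ n], so [nu] is small there, and [nu_ n] is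
at least [nu_ n (f_ n <= - K)] minus [K] times a small measure, which is almost
nonnegative by (ii). The constants are chosen in the order [K], [M], [n].

The subsequence is obtained from the convergence in measure by the
Borel-Cantelli lemma ([ae_subsequence]). *)

Set Implicit Arguments.
Unset Strict Implicit.
Unset Printing Implicit Defensive.

Import Order.TTheory GRing.Theory Num.Theory.
Import numFieldNormedType.Exports.

Local Open Scope classical_set_scope.
Local Open Scope ring_scope.
Local Open Scope ereal_scope.

(** * Limits inferior and limits of nonnegative functions *)

Lemma le_limf_einfP (T : choiceType) (X : filteredType T) (R : realType)
    (F : set_system X) (FF : Filter F) (u : X -> \bar R) (l : R) :
  l%:E <= limf_einf u F <->
  forall e : R, (0 < e)%R -> \forall x \near F, (l - e)%:E <= u x.
Proof.
rewrite limf_einfE; split=> [lu e e0|lu].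
  have : (l - e)%:E < ereal_sup [set ereal_inf [set u x | x in V] | V in F].
    by apply: lt_le_trans lu; rewrite lte_fin ltrBlDr ltrDl.
  move=> /ereal_sup_gt[_ [V FV <-]] /ltW leV.
  apply: filterS FV => x Vx; apply: le_trans leV _.
  by apply: ereal_inf_lbound; exists x.
apply/lee_addgt0Pr => e e0; rewrite -leeBlDr// -EFinB.
apply: le_ereal_sup_tmp.
exists (ereal_inf [set u x | x in [set x | (l - e)%:E <= u x]]).
  by exists [set x | (l - e)%:E <= u x] => //; exact: lu.
by apply: le_ereal_inf_tmp => _ [x /= lux <-].
Qed.

Lemma nonneg_cvg0P (T : Type) (R : realType) (F : set_system T)
    (FF : Filter F) (u : T -> \bar R) : (forall x, 0 <= u x) ->
  u @ F --> 0 <-> forall e : R, (0 < e)%R -> \forall x \near F, u x <= e%:E.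
Proof.
move=> u0; split=> [/fine_cvgP[ufin ucvg] e e0|ue].
  have /cvgr0Pnorm_le /(_ _ e0) := ucvg.
  apply: filterS2 ufin => x ux; rewrite /= ger0_norm ?fine_ge0// => uxe.
  by rewrite -(fineK ux) lee_fin.
apply/fine_cvgP; split.
  apply: filterS (ue 1%R ltr01) => x ux.
  by rewrite ge0_fin_numE// (le_lt_trans ux)// ltry.
apply/cvgr0Pnorm_le => e e0; apply: filterS (ue e e0) => x ux /=.
have ufin : u x \is a fin_num by rewrite ge0_fin_numE// (le_lt_trans ux)// ltry.
by rewrite ger0_norm ?fine_ge0// -lee_fin fineK.
Qed.

(** * Tails of integrable functions *)

Section integrable_tail.
Context d (T : measurableType d) (R : realType) (mu : {measure set T -> \bar R}).
Variable f : T -> \bar R.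
Hypothesis intf : mu.-integrable [set: T] f.

Let mf : measurable_fun [set: T] f. Proof. exact: measurable_int intf. Qed.

Lemma measurable_tail (M : R) : measurable [set x | M%:E <= `|f x|].
Proof.
rewrite -[X in measurable X]setTI; apply: emeasurable_fun_c_infty => //.
exact: measurableT_comp.
Qed.

(** Dominated convergence applied to [|f|] restricted to [n <= |f|], which
vanishes eventually at each point where [f] is finite. *)
Lemma integrable_tail (e : R) : (0 < e)%R ->
  \forall M \near +oo%R, \int[mu]_(x in [set x | M%:E <= `|f x|]) `|f x| <= e%:E.
Proof.
move=> e0.
pose g (n : nat) := (abse \o f) \_ [set x | n%:R%:E <= `|f x|].
have mg n : measurable_fun setT (g n).
  apply/(measurable_restrictT _ (measurable_tail _)).1.
  by apply: measurable_funTS; exact: measurableT_comp.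
have [||||_ _] := @dominated_convergence _ _ _ mu setT measurableT g (cst 0)
  (abse \o f) mg.
- exact: measurable_cst.
- have := integrable_ae measurableT intf; apply: filterS => x /(_ I) fx _.
  apply: cvg_near_cst; near=> n; rewrite /g patchE ifF//.
  apply/negbTE; rewrite notin_setE /=; apply/negP; rewrite -ltNge.
  rewrite -(fineK fx) lte_fin.
  near: n; exact: nbhs_infty_gtr.
- exact: integrable_abse.
- apply: aeW => x n _; rewrite /g patchE; case: ifP => _ /=.
    by rewrite abse_id.
  by rewrite normr0 abse_ge0.
rewrite integral0 => gcvg.
have g_ge0 n : 0 <= \int[mu]_x g n x.
  apply: integral_ge0 => x _; rewrite /g patchE.
  by case: ifP => _; [exact: abse_ge0|exact: lexx].
have [N _ /(_ N (leqnn N)) /= gN] := (nonneg_cvg0P _ g_ge0).1 gcvg _ e0.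
exists N%:R; split => [|M NM]; first exact: num_real.
apply: le_trans gN; rewrite /g -integral_mkcond.
apply: ge0_subset_integral => //; try exact: measurable_tail.
- by apply: measurable_funTS; exact: measurableT_comp.
- by move=> x /=; apply: le_trans; rewrite lee_fin ltW.
Unshelve. all: by end_near. Qed.

Lemma markov_tail (M : R) : (0 < M)%R ->
  M%:E * mu [set x | M%:E <= `|f x|] <=
  \int[mu]_(x in [set x | M%:E <= `|f x|]) `|f x|.
Proof.
move=> M0.
have := le_integral_abse mu (measurable_tail M) (measurable_funTS mf) M0.
by rewrite setIid.
Qed.

End integrable_tail.

(** * Finite measures and total variation *)

Section bounded_functions.
Context d (T : measurableType d) (R : realType).
Implicit Types (mu : {measure set T -> \bar R}) (A : set T).

Lemma measure_fin_num mu A : mu [set: T] < +oo -> measurable A ->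
  mu A \is a fin_num.
Proof.
move=> muoo mA; rewrite ge0_fin_numE//; apply: le_lt_trans muoo.
by apply: le_measure; rewrite ?inE.
Qed.

Lemma bounded_integrable mu A (h : T -> R) (c : R) : mu [set: T] < +oo ->
  measurable A -> measurable_fun A h -> (forall x, A x -> `|h x| <= c)%R ->
  mu.-integrable A (EFin \o h).
Proof.
move=> muoo mA mh hc; apply: measurable_bounded_integrable => //.
  by rewrite ltey_eq measure_fin_num.
exists c; split; first exact: num_real.
by move=> M cM x Ax; rewrite /= (le_trans (hc x Ax))// ltW.
Qed.

Lemma le_fine_measure mu A B : mu [set: T] < +oo ->
  measurable A -> measurable B -> A `<=` B -> (fine (mu A) <= fine (mu B))%R.
Proof.
move=> muoo mA mB AB; apply: fine_le; try exact: measure_fin_num.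
by apply: le_measure; rewrite ?inE.
Qed.

Lemma fine_measureU2 mu A B : mu [set: T] < +oo ->
  measurable A -> measurable B ->
  (fine (mu (A `|` B)) <= fine (mu A) + fine (mu B))%R.
Proof.
move=> muoo mA mB; rewrite -fineD ?measure_fin_num//; apply: fine_le.
- by apply: measure_fin_num => //; exact: measurableU.
- by rewrite fin_numD !measure_fin_num.
- exact: measureU2.
Qed.

End bounded_functions.

Section total_variation.
Context d (T : measurableType d) (R : realType).
Variables mu' mu : {measure set T -> \bar R}.

(** The constant test function [1] has infinite integral against an infinite
measure. *)
Lemma tv_dist_lty : mu' [set: T] < +oo -> tv_dist mu' mu < +oo ->
  mu [set: T] < +oo.
Proof.
move=> mu'oo tv; rewrite ltNge leye_eq; apply/negP => /eqP muoo.
move: tv; rewrite ltNge => /negP; apply.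
apply: ereal_sup_ubound; exists (cst 1%R).
  split=> [|x]; first exact: measurable_cst.
  by rewrite /= lexx andbT (@le_trans _ _ 0%R) ?lerN10.
have int1 (m : {measure set T -> \bar R}) :
    \int[m]_x (cst 1%R x : R)%:E = m [set: T].
  by rewrite -[RHS]mul1e -integral_cst.
rewrite !int1 muoo.
have : mu' setT \is a fin_num by rewrite measure_fin_num.
by move=> /fineK <-.
Qed.

Hypotheses (mu'oo : mu' [set: T] < +oo) (muoo : mu [set: T] < +oo).
Variable delta : R.
Hypothesis tv : tv_dist mu' mu <= delta%:E.

(** The test functions of [tv_dist] are bounded by [1], hence the scaling
by [c]. *)
Lemma tv_dist_Rintegral (h : T -> R) (c : R) : (0 < c)%R ->
  measurable_fun [set: T] h -> (forall x, `|h x| <= c)%R ->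
  (`|\int[mu']_x h x - \int[mu]_x h x| <= c * delta)%R.
Proof.
move=> c0 mh hc.
have inth (m : {measure set T -> \bar R}) : m [set: T] < +oo ->
    m.-integrable [set: T] (EFin \o h).
  by move=> moo; apply: (bounded_integrable (c := c)).
have mg : measurable_fun [set: T] (fun x => c^-1 * h x)%R.
  exact: measurable_funM.
have gE (m : {measure set T -> \bar R}) : m [set: T] < +oo ->
    \int[m]_x (c^-1 * h x)%:E = (c^-1 * \int[m]_x h x)%:E.
  move=> moo; rewrite -RintegralZl ?fineK//; last exact: inth.
  apply: integrable_fin_num => //.
  exact: (integrableZl _ _ (inth _ moo)).
rewrite mulrC -ler_pdivrMr// mulrC -(gtr0_norm (x := c^-1)) ?invr_gt0//.
rewrite -normrM mulrBr -lee_fin; apply: le_trans tv.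
apply: ereal_sup_ubound; exists (fun x => c^-1 * h x)%R.
  split=> // x; rewrite -ler_norml normrM gtr0_norm ?invr_gt0//.
  by rewrite mulrC ler_pdivrMr// mul1r.
by rewrite !gE.
Qed.

Lemma tv_dist_measure A : measurable A ->
  (fine (mu' A) <= fine (mu A) + delta)%R.
Proof.
move=> mA; rewrite -lerBlDl -[leRHS]mul1r.
have indE (m : {measure set T -> \bar R}) : fine (m A) = (\int[m]_x \1_A x)%R.
  by rewrite /Rintegral integral_indic// setIT.
rewrite !indE; apply: le_trans (ler_norm _) _.
by apply: tv_dist_Rintegral => // x; rewrite ger0_norm//.
Qed.

End total_variation.

(** * Bounds on a charge from its density *)

Section Radon_Nikodym_estimates.
Context d (T : measurableType d) (R : realType).
Variables (mu : {measure set T -> \bar R}) (nu : {charge set T -> \bar R}).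
Variable f : T -> \bar R.
Hypotheses (muoo : mu [set: T] < +oo) (RNf : is_Radon_Nikodym nu mu f).
Implicit Types (S : set T) (c K M t : R).

Let intf S : measurable S -> mu.-integrable S f.
Proof. by move=> mS; apply: integrableS RNf.1. Qed.

Lemma is_Radon_Nikodym_measurable : measurable_fun [set: T] f.
Proof. exact: measurable_int RNf.1. Qed.

Let intcst S c : measurable S -> mu.-integrable S (cst c%:E).
Proof.
by move=> mS; apply: (bounded_integrable (h := cst c) (c := `|c|%R)).
Qed.

Let integral_cstE S c : measurable S ->
  \int[mu]_(x in S) c%:E = (c * fine (mu S))%:E.
Proof.
by move=> mS; rewrite integral_cst// EFinM fineK// measure_fin_num.
Qed.

Lemma Radon_Nikodym_ub S c : measurable S -> (forall x, S x -> f x <= c%:E) ->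
  (fine (nu S) <= c * fine (mu S))%R.
Proof.
move=> mS fc; rewrite -lee_fin fineK ?fin_num_measure// RNf.2// -integral_cstE//.
by apply: le_integral => //; [exact: intf|exact: intcst|move=> x /set_mem/fc].
Qed.

Lemma Radon_Nikodym_lb S c : measurable S -> (forall x, S x -> c%:E <= f x) ->
  (c * fine (mu S) <= fine (nu S))%R.
Proof.
move=> mS fc; rewrite -lee_fin fineK ?fin_num_measure// RNf.2// -integral_cstE//.
by apply: le_integral => //; [exact: intcst|exact: intf|move=> x /set_mem/fc].
Qed.

Lemma Radon_Nikodym_abs S : measurable S ->
  `|fine (nu S)|%:E <= \int[mu]_(x in S) `|f x|.
Proof.
move=> mS; rewrite -abse_EFin fineK ?fin_num_measure// RNf.2//.
apply: le_abse_integral => //.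
by apply: measurable_funTS; exact: is_Radon_Nikodym_measurable.
Qed.

Let mabsf S : measurable_fun S (abse \o f).
Proof.
apply: measurable_funTS; apply: measurableT_comp => //.
exact: is_Radon_Nikodym_measurable.
Qed.

Lemma Radon_Nikodym_abs_tail S M t : measurable S ->
  S `<=` [set x | M%:E <= `|f x|] ->
  \int[mu]_(x in [set x | M%:E <= `|f x|]) `|f x| <= t%:E ->
  (`|fine (nu S)| <= t)%R.
Proof.
move=> mS SL; rewrite -lee_fin; apply: le_trans.
apply: le_trans (Radon_Nikodym_abs mS) _.
by apply: ge0_subset_integral => //; exact: measurable_tail RNf.1 _.
Qed.

(** A quantitative form of [nu `<< mu]: the density is at most [M] in absolute
value outside of its tail. *)
Lemma Radon_Nikodym_abs_continuous S M t : measurable S -> (0 <= M)%R ->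
  \int[mu]_(x in [set x | M%:E <= `|f x|]) `|f x| <= t%:E ->
  (`|fine (nu S)| <= M * fine (mu S) + t)%R.
Proof.
move=> mS M0 tM; set L := [set x | M%:E <= `|f x|] in tM.
have mL : measurable L by exact: measurable_tail RNf.1 _.
have mSL : measurable (S `\` L) by exact: measurableD.
have mSIL : measurable (S `&` L) by exact: measurableI.
rewrite (chargeDI nu mS mL) fineD ?fin_num_measure//.
apply: le_trans (ler_normD _ _) _; apply: lerD; last first.
  by apply: Radon_Nikodym_abs_tail tM => //; exact: subIsetr.
have fM x : (S `\` L) x -> - M%:E < f x < M%:E.
  by move=> [_ /negP]; rewrite -ltNge lte_absl.
apply: (@le_trans _ _ (M * fine (mu (S `\` L)))%R); last first.
  by rewrite ler_wpM2l// le_fine_measure//; exact: subDsetl.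
rewrite ler_norml; apply/andP; split.
  rewrite -mulNr; apply: Radon_Nikodym_lb => // x /fM/andP[+ _]; exact: ltW.
by apply: Radon_Nikodym_ub => // x /fM/andP[_]; exact: ltW.
Qed.

Lemma measurable_Radon_Nikodym_le K : measurable [set x | f x <= K%:E].
Proof.
rewrite -[X in measurable X]setTI; apply: emeasurable_fun_infty_c => //.
exact: is_Radon_Nikodym_measurable.
Qed.

(** Among the subsets of [f <= - K], where the density is nonpositive, the
charge is smallest on the whole set; on the rest of [S] the density is at
least [- K]. *)
Lemma Radon_Nikodym_lower S K : measurable S -> (0 <= K)%R ->
  (fine (nu [set x | (f x <= (- K)%:E)%E]) - K * fine (mu S) <= fine (nu S))%R.
Proof.
move=> mS K0; set L := [set x | _].
have mL : measurable L by exact: measurable_Radon_Nikodym_le.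
have mSL : measurable (S `\` L) by exact: measurableD.
have mLS : measurable (L `\` S) by exact: measurableD.
have mSIL : measurable (S `&` L) by exact: measurableI.
have mLIS : measurable (L `&` S) by exact: measurableI.
rewrite (chargeDI nu mS mL) (chargeDI nu mL mS) !fineD ?fin_num_measure//.
have : (fine (nu (L `\` S)) <= 0 * fine (mu (L `\` S)))%R.
  apply: Radon_Nikodym_ub => // x [/= fx _]; apply: le_trans fx _.
  by rewrite lee_fin oppr_le0.
have : (- K * fine (mu (S `\` L)) <= fine (nu (S `\` L)))%R.
  apply: Radon_Nikodym_lb => // x [_ /negP]; rewrite -ltNge => /ltW.
  exact.
have : (K * fine (mu (S `\` L)) <= K * fine (mu S))%R.
  by rewrite ler_wpM2l// le_fine_measure//; exact: subDsetl.
by rewrite (setIC L S) mul0r mulNr; lra.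
Qed.

End Radon_Nikodym_estimates.

(** * Comparison of charges with densities for nearby measures *)

Section Radon_Nikodym_comparison.
Context d (T : measurableType d) (R : realType).
Variables mu' mu : {measure set T -> \bar R}.
Variables nu' nu : {charge set T -> \bar R}.
Variables f' f : T -> \bar R.
Hypotheses (mu'oo : mu' [set: T] < +oo) (muoo : mu [set: T] < +oo).
Hypotheses (RNf' : is_Radon_Nikodym nu' mu' f') (RNf : is_Radon_Nikodym nu mu f).
Variable delta : R.
Hypothesis tv : tv_dist mu' mu <= delta%:E.
Variables (S : set T) (M e : R).
Hypotheses (mS : measurable S) (M0 : (0 < M)%R) (e0 : (0 <= e)%R).
Hypothesis fM : forall x, S x -> `|f x| <= M%:E.

Let f_fin x : S x -> f x \is a fin_num.
Proof.
move=> /fM fx.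
by rewrite -abse_fin_num ge0_fin_numE// (le_lt_trans fx)// ltry.
Qed.

Let g x : R := (fine (f x) - e)%R.

Let gE x : S x -> (g x)%:E = f x - e%:E.
Proof. by move=> Sx; rewrite /g EFinB fineK// f_fin. Qed.

Let mfine : measurable_fun S (fine \o f).
Proof.
apply: measurableT_comp => //; apply: measurable_funTS.
exact: is_Radon_Nikodym_measurable RNf.
Qed.

Let mg : measurable_fun S g.
Proof. by apply: measurable_funB => //; exact: measurable_cst. Qed.

Let gM x : S x -> (`|g x| <= M + e)%R.
Proof.
move=> Sx; apply: le_trans (ler_normB _ _) _; rewrite (ger0_norm e0) lerD2r.
by rewrite -lee_fin -abse_EFin fineK ?f_fin// fM.
Qed.

Let intg (m : {measure set T -> \bar R}) : m [set: T] < +oo ->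
  m.-integrable S (EFin \o g).
Proof. by move=> moo; exact: (bounded_integrable moo mS mg gM). Qed.

(* [g] is bounded on [S], so its integrals against [mu'] and [mu] are close
   although those of [f'] and [f] cannot be compared directly. *)
Let int_g : (\int[mu]_(x in S) g x = fine (nu S) - e * fine (mu S))%R.
Proof.
rewrite RintegralB//.
- rewrite Rintegral_cst//; congr (_ - _)%R; rewrite /Rintegral RNf.2//.
  by congr fine; apply: eq_integral => x /set_mem Sx; rewrite fineK// f_fin.
- apply: (bounded_integrable (c := M)) => // x Sx.
  by rewrite -lee_fin -abse_EFin fineK ?f_fin// fM.
- by apply: (bounded_integrable (c := e)) => // x Sx; rewrite ger0_norm.
Qed.

Let int_g_tv :
  (`|\int[mu']_(x in S) g x - (fine (nu S) - e * fine (mu S))| <=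
   (M + e) * delta)%R.
Proof.
rewrite -int_g ![(\int[_]_(x in S) _)%R]Rintegral_mkcond.
apply: tv_dist_Rintegral => //; first by rewrite ltr_wpDr.
  exact/(measurable_restrictT _ mS).1.
move=> x; rewrite patchE; case: ifPn => [/set_mem/gM//|_].
by rewrite normr0 addr_ge0// ltW.
Qed.

Let intf' : mu'.-integrable S f'.
Proof. by apply: integrableS RNf'.1. Qed.

(** [nu' S] is the integral of [f'] against [mu'], which is bounded by that of
[f - e]; the latter is a bounded function on [S], so [mu'] can be replaced
with [mu]. *)
Lemma charge_le_tv : (forall x, S x -> f' x <= f x - e%:E) ->
  (fine (nu' S) <= fine (nu S) - e * fine (mu S) + (M + e) * delta)%R.
Proof.
move=> ff'; have : (fine (nu' S) <= \int[mu']_(x in S) g x)%R.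
  rewrite RNf'.2//; apply: fine_le; try exact: integrable_fin_num (intg mu'oo).
    exact: integrable_fin_num intf'.
  apply: le_integral => //; first exact: intg.
  by move=> x /set_mem Sx; rewrite /= gE// ff'.
by have := int_g_tv; rewrite ler_norml; lra.
Qed.

Lemma charge_ge_tv : (forall x, S x -> f x - e%:E <= f' x) ->
  (fine (nu S) - e * fine (mu S) - (M + e) * delta <= fine (nu' S))%R.
Proof.
move=> ff'; have : (\int[mu']_(x in S) g x <= fine (nu' S))%R.
  rewrite RNf'.2//; apply: fine_le; try exact: integrable_fin_num (intg mu'oo).
    exact: integrable_fin_num intf'.
  apply: le_integral => //; first exact: intg.
  by move=> x /set_mem Sx; rewrite /= gE// ff'.
by have := int_g_tv; rewrite ler_norml; lra.
Qed.

End Radon_Nikodym_comparison.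

(** * Almost everywhere minorization along a subsequence *)

(** With [e k = 2 ^- k.+1], choose [n_ k] so large that the exceptional set at
level [e k] has measure at most [e k]. By Borel-Cantelli almost every point lies
in finitely many of these sets, and so satisfies [f s - e k < f_ (n_ k) s] for
all large [k]. Finiteness of [f] is what allows to pass from this to the
limit inferior. *)
Lemma ae_subsequence d (T : measurableType d) (R : realType)
    (mu : {measure set T -> \bar R}) (f_ : nat -> T -> \bar R) (f : T -> \bar R) :
  (forall n, measurable_fun [set: T] (f_ n)) -> measurable_fun [set: T] f ->
  {ae mu, forall x, f x \is a fin_num} ->
  (forall eps : R, (0 < eps)%R ->
    mu [set s | f_ n s <= f s - eps%:E] @[n --> \oo] --> 0) ->
  exists2 n_ : nat -> nat, increasing_seq n_ &
    {ae mu, forall s, f s <= limn_einf (fun k => f_ (n_ k) s)}.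
Proof.
move=> mf_ mf ffin cvg0.
pose A (e : R) n := [set s | f_ n s <= f s - e%:E].
have mA e n : measurable (A e n).
  rewrite -[A e n]setTI; apply: measurable_lee => //.
  by apply: emeasurable_funB => //; exact: measurable_cst.
pose e k : R := (1 / (2 ^ k.+1)%:R)%R.
have e_gt0 k : (0 < e k)%R by rewrite divr_gt0// ltr0n expn_gt0.
have /choice[N NP] k : exists N, forall n, (N <= n)%N -> mu (A (e k) n) <= (e k)%:E.
  have [N _ NP] := (nonneg_cvg0P _ (fun n => measure_ge0 mu (A (e k) n))).1
    (cvg0 _ (e_gt0 k)) _ (e_gt0 k).
  by exists N => n /NP.
(* Partial sums of the thresholds make the subsequence strictly increasing while
   keeping it above each threshold. *)
pose n_ k := (\sum_(i < k.+1) (N i).+1)%N.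
have N_n_ k : (N k <= n_ k)%N.
  by rewrite /n_ big_ord_recr/=; apply: leq_trans (leq_addl _ _); exact: leqnSn.
exists n_.
  apply/increasing_seqP => k; rewrite /n_ [ltRHS]big_ord_recr/=.
  by rewrite ltEnat/= -[ltnLHS]addn0 ltn_add2l.
pose F k := A (e k) (n_ k).
have F0 : mu (lim_sup_set F) = 0.
  apply: lim_sup_set_cvg0 => [k|]; first exact: mA.
  apply: le_lt_trans (ltry 1%R); apply: le_trans (epsilon_trick0 _ (@ler01 R)).
  by apply: lee_nneseries => // k _; exact: NP.
have aeF : {ae mu, forall s, ~ lim_sup_set F s}.
  exists (lim_sup_set F); split => // [|s /contrapT//].
  apply: bigcapT_measurable => k; apply: bigcup_measurable => j _.
  exact: mA.
apply: filterS2 ffin aeF => s fs Fs; rewrite -(fineK fs).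
apply/le_limf_einfP => eps eps0.
have [k0 Fk0] : exists k0, forall k, (k0 <= k)%N -> ~ F k s.
  apply: contrapT => /forallNP noF; apply: Fs => k _.
  have /existsNP[j /not_implyP[kj /contrapT Fj]] := noF k.
  by exists j.
near=> k; have /negP : ~ F k s by apply: Fk0; near: k; exact: nbhs_infty_ge.
rewrite -ltNge => /ltW; apply: le_trans.
rewrite EFinB fineK// leeB// lee_fin.
apply: (@le_trans _ _ (k.+1%:R^-1)%R); last first.
  by apply: ltW; near: k; exact: near_infty_natSinv_lt (PosNum eps0).
rewrite /e div1r lef_pV2 ?posrE ?ltr0n ?expn_gt0// ler_nat.
exact/ltnW/ltn_expl.
Unshelve. all: by end_near. Qed.

(** * The three conditions in epsilon form and their relations *)

Section uniform_Fatou.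
Context d (T : measurableType d) (R : realType).
Variables (mu_ : nat -> {finite_measure set T -> \bar R}).
Variables (mu : {measure set T -> \bar R}).
Variables (nu_ : nat -> {charge set T -> \bar R}) (nu : {charge set T -> \bar R}).
Variables (f_ : nat -> T -> \bar R) (f : T -> \bar R).
Hypothesis RNf_ : forall n, is_Radon_Nikodym (nu_ n) (mu_ n) (f_ n).
Hypothesis RNf : is_Radon_Nikodym nu mu f.
Hypothesis tv_cvg : tv_dist (mu_ n) mu @[n --> \oo] --> 0.

Lemma near_tv_dist (delta : R) : (0 < delta)%R ->
  \forall n \near \oo, tv_dist (mu_ n) mu <= delta%:E.
Proof.
move=> d0; apply: ((nonneg_cvg0P _ _).1 tv_cvg) => // n.
apply: le_trans (ereal_sup_ubound _); last first.
  exists (cst 0%R); last reflexivity.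
  by split=> [|x]; [exact: measurable_cst|rewrite /= ler01 lerN10].
exact: abse_ge0.
Qed.

Let mu_oo n : mu_ n [set: T] < +oo.
Proof. by rewrite ltey_eq fin_num_measure. Qed.

(** Total variation convergence forces the limit to be finite: one index at
finite distance suffices. *)
Lemma limit_measure_lty : mu [set: T] < +oo.
Proof.
have [N _ /(_ N (leqnn N))/= tvN] := near_tv_dist ltr01.
apply: tv_dist_lty (mu_oo N) _.
exact: le_lt_trans tvN (ltry _).
Qed.
Let muoo := limit_measure_lty.

Let mf : measurable_fun [set: T] f.
Proof. exact: is_Radon_Nikodym_measurable RNf. Qed.
Let mf_ n : measurable_fun [set: T] (f_ n).
Proof. exact: is_Radon_Nikodym_measurable (RNf_ n). Qed.

Let A e n := [set s | f_ n s <= f s - e%:E].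
Let L M := [set s | M%:E <= `|f s|].

Let mA e n : measurable (A e n).
Proof.
rewrite -[A e n]setTI; apply: measurable_lee => //.
by apply: emeasurable_funB => //; exact: measurable_cst.
Qed.

Let mL M : measurable (L M). Proof. exact: measurable_tail RNf.1 M. Qed.

Let fL M t : (0 < M)%R -> \int[mu]_(x in L M) `|f x| <= t%:E ->
  (M * fine (mu (L M)) <= t)%R.
Proof.
move=> M0 tM; rewrite -lee_fin EFinM fineK ?measure_fin_num//.
by apply: le_trans tM; exact: markov_tail RNf.1 _ M0.
Qed.

Definition uniform_minorant := forall e : R, (0 < e)%R ->
  \forall n \near \oo, forall S, measurable S ->
    (fine (nu S) - e <= fine (nu_ n S))%R.

Definition minorant_in_measure := forall eps e : R, (0 < eps)%R -> (0 < e)%R ->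
  \forall n \near \oo, (fine (mu [set s | (f_ n s <= f s - eps%:E)%E]) <= e)%R.

Definition vanishing_lower_tails := forall e : R, (0 < e)%R ->
  \forall K \near +oo%R,
    forall n, (- e <= fine (nu_ n [set s | (f_ n s <= (- K)%:E)%E]))%R.

(** On [S], the part of [f_ n <= f - eps] where [|f| < M], the upper bound
[nu_ n S <= nu S - eps * mu S + (M + eps) * delta] meets the lower bound given by
the uniform minorant, so that [mu S] is of the order of the errors. *)
Lemma uniform_minorant_in_measure : uniform_minorant -> minorant_in_measure.
Proof.
move=> unif eps e eps0 e0.
have e20 : (0 < e / 2)%R by rewrite divr_gt0.
have [M M1 tM] : exists2 M : R, (1 <= M)%R &
    \int[mu]_(x in L M) `|f x| <= (e / 2)%:E.
  have : \forall M \near +oo%R, (1 <= M)%R /\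
      \int[mu]_(x in L M) `|f x| <= (e / 2)%:E.
    near=> M; split; first by near: M; exact: nbhs_pinfty_ge.
    by near: M; exact: integrable_tail RNf.1 _ e20.
  by move=> /filter_ex[M [? ?]]; exists M.
have M0 : (0 < M)%R by exact: lt_le_trans M1.
pose delta := (eps * e / 4 / (M + eps))%R.
have Meps0 : (0 < M + eps)%R by rewrite addr_gt0.
have h0 : (0 < eps * e / 4)%R by rewrite divr_gt0// mulr_gt0.
have delta0 : (0 < delta)%R by rewrite divr_gt0.
near=> n.
have tvn : tv_dist (mu_ n) mu <= delta%:E by near: n; exact: near_tv_dist.
have unifn S : measurable S ->
    (fine (nu S) - eps * e / 4 <= fine (nu_ n S))%R.
  by move: S; near: n; exact: unif.
have mS : measurable (A eps n `\` L M) by exact: measurableD.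
have := charge_le_tv (mu_oo n) muoo (RNf_ n) RNf tvn mS M0 (ltW eps0).
have fM x : (A eps n `\` L M) x -> `|f x| <= M%:E.
  by move=> [_ /negP]; rewrite -ltNge => /ltW.
move=> /(_ fM) /(_ (fun x Sx => Sx.1)).
have -> : ((M + eps) * delta = eps * e / 4)%R.
  by rewrite /delta mulrC divfK// gt_eqF.
have := unifn _ mS => {unifn} h1 h2.
have h3 : (fine (mu (A eps n `\` L M)) <= e / 2)%R.
  by rewrite -(ler_pM2l eps0); lra.
have h4 : (fine (mu (L M)) <= e / 2)%R.
  by apply: le_trans (fL M0 tM); rewrite ler_peMl// fine_ge0.
have h5 : (fine (mu (A eps n)) <= fine (mu ((A eps n `\` L M) `|` L M)))%R.
  apply: le_fine_measure => //; first exact: measurableU.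
  by move=> x Ax; have [Lx|Lx] := pselect (L M x); [right|left].
have := fine_measureU2 muoo mS (mL M); rewrite -/(A eps n); lra.
Unshelve. all: by end_near. Qed.

(** Where [f_ n <= - K], either [f_ n <= f - 1], a set of small measure
for large [n], or [f < 1 - K], a set of small measure for large [K]. So [nu] is
small there, and the uniform minorant transfers this to [nu_ n]. *)
Lemma uniform_minorant_lower_tails : uniform_minorant -> minorant_in_measure ->
  vanishing_lower_tails.
Proof.
move=> unif inmeas e e0.
have t0 : (0 < e / 4)%R by rewrite divr_gt0.
have [M M0 tM] : exists2 M : R, (0 < M)%R &
    \int[mu]_(x in L M) `|f x| <= (e / 4)%:E.
  have : \forall M \near +oo%R, (0 < M)%R /\
      \int[mu]_(x in L M) `|f x| <= (e / 4)%:E.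
    near=> M; split; first by near: M; exact: nbhs_pinfty_gt.
    by near: M; exact: integrable_tail RNf.1 _ t0.
  by move=> /filter_ex[M [? ?]]; exists M.
pose eta := (e / 4 / M)%R.
have eta0 : (0 < eta)%R by rewrite divr_gt0.
have [N NP] : exists N, forall n, (N <= n)%N ->
    (fine (mu (A 1 n)) <= eta)%R /\
    forall S, measurable S -> (fine (nu S) - e / 4 <= fine (nu_ n S))%R.
  have : \forall n \near \oo, (fine (mu (A 1 n)) <= eta)%R /\
      forall S, measurable S -> (fine (nu S) - e / 4 <= fine (nu_ n S))%R.
    near=> n; split; first by near: n; exact: inmeas.
    by near: n; exact: unif.
  by move=> [N _ NP]; exists N => n /NP.
(* For the finitely many indices before [N], [K] may depend on the index. *)
have early : \forall K \near +oo%R, forall i : 'I_N,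
    \int[mu_ i]_(x in [set x | K%:E <= `|f_ i x|]) `|f_ i x| <= e%:E.
  by apply: filter_forall => i; exact: integrable_tail (RNf_ i).1 _ e0.
have [K0 [_ K0P]] := integrable_tail RNf.1 eta0.
near=> K => n.
have mS : measurable [set s | f_ n s <= (- K)%:E].
  exact: measurable_Radon_Nikodym_le (RNf_ n) _.
have K2 : (2 <= K)%R by near: K; exact: nbhs_pinfty_ge.
have KK0 : (K0 < K - 1)%R.
  by rewrite ltrBrDr; near: K; apply: nbhs_pinfty_gt; exact: num_real.
have [nN|Nn] := ltnP n N.
  have tailn : \int[mu_ n]_(x in [set x | K%:E <= `|f_ n x|]) `|f_ n x| <= e%:E.
    have /(_ (Ordinal nN)) // : forall i : 'I_N,
      \int[mu_ i]_(x in [set x | K%:E <= `|f_ i x|]) `|f_ i x| <= e%:E.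
    by near: K.
  have := Radon_Nikodym_abs_tail (RNf_ n) mS _ tailn.
  rewrite ler_norml => /(_ _)/andP[]// x /=.
  by rewrite EFinN leeNr => /le_trans; apply; rewrite -abseN lee_abs.
have [An unifn] := NP n Nn.
have SAL : [set s | f_ n s <= (- K)%:E] `<=` A 1 n `|` L (K - 1).
  move=> s /= fK; have [|fns] := leP (f_ n s) (f s - 1%:E); [by left|right].
  have := lt_le_trans fns fK; rewrite /L /=.
  case: (f s) => [r| |] /=; [|by rewrite leey|by rewrite leey].
  by rewrite -EFinB lte_fin lee_fin ler_normr => ?; apply/orP; right; lra.
have muL : (fine (mu (L (K - 1))) <= eta)%R.
  have K1 : (1 <= K - 1)%R by lra.
  apply: le_trans (fL (lt_le_trans ltr01 K1) (K0P _ KK0)).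
  by rewrite ler_peMl// fine_ge0.
have muS : (fine (mu [set s | (f_ n s <= (- K)%:E)%E]) <= 2 * eta)%R.
  have := le_fine_measure muoo mS (measurableU _ _ (mA 1 n) (mL (K - 1))) SAL.
  have := fine_measureU2 muoo (mA 1 n) (mL (K - 1)).
  lra.
have := Radon_Nikodym_abs_continuous muoo RNf mS (ltW M0) tM.
have := unifn _ mS.
have : (M * fine (mu [set s | (f_ n s <= (- K)%:E)%E]) <= M * (2 * eta))%R.
  by rewrite ler_wpM2l// ltW.
have -> : (M * (2 * eta) = e / 2)%R.
  by rewrite /eta; field; rewrite gt_eqF.
rewrite ler_norml => h1 h2 /andP[h3 _]; lra.
Unshelve. all: by end_near. Qed.

(** The set [S] is split along [B], the union of [f_ n <= f - eps] and
[M <= |f|]. On [S `\` B] the densities are compared directly; [S `&` B] is small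
for both measures, which bounds [nu] by [M * mu (S `&` B)] plus a tail, and
[nu_ n] from below by the lower tail at [- K] minus [K * mu_ n (S `&` B)]. *)
Lemma lower_tails_uniform_minorant : minorant_in_measure ->
  vanishing_lower_tails -> uniform_minorant.
Proof.
move=> inmeas tails e0 e0_gt0.
(* The total loss is at most [9 * t]: two units on [S `\` B], three for [nu] on
   [S `&` B], and four for [nu_ n] on [S `&` B]. *)
pose t := (e0 / 9)%R; have t0 : (0 < t)%R by rewrite divr_gt0.
have [K K0 tailsK] : exists2 K : R, (0 <= K)%R &
    forall n, (- t <= fine (nu_ n [set s | (f_ n s <= (- K)%:E)%E]))%R.
  have : \forall K \near +oo%R, (0 <= K)%R /\
      forall n, (- t <= fine (nu_ n [set s | (f_ n s <= (- K)%:E)%E]))%R.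
    near=> K; split; first by near: K; exact: nbhs_pinfty_ge.
    by near: K; exact: tails.
  by move=> /filter_ex[K [? ?]]; exists K.
(* [K <= M] makes [K * mu (L M)] at most the tail of [f] at [M], by the Markov
   inequality. *)
have [M [M1 KM tM]] : exists M : R, [/\ (1 <= M)%R, (K <= M)%R &
    \int[mu]_(x in L M) `|f x| <= t%:E].
  have : \forall M \near +oo%R, [/\ (1 <= M)%R, (K <= M)%R &
      \int[mu]_(x in L M) `|f x| <= t%:E].
    near=> M; split.
    - by near: M; exact: nbhs_pinfty_ge.
    - by near: M; apply: nbhs_pinfty_ge; exact: num_real.
    - by near: M; exact: integrable_tail RNf.1 _ t0.
  by move=> /filter_ex[M ?]; exists M.
have M0 : (0 < M)%R by exact: lt_le_trans M1.
pose m := fine (mu [set: T]); have m0 : (0 <= m)%R by rewrite fine_ge0.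
pose eps := (t / (m + 1))%R.
have eps0 : (0 < eps)%R by rewrite divr_gt0// ltr_wpDl.
pose eta := (t / M)%R; have eta0 : (0 < eta)%R by rewrite divr_gt0.
pose delta := (t / (M + eps))%R.
have delta0 : (0 < delta)%R by rewrite divr_gt0// addr_gt0.
near=> n => S mS.
have tvn : tv_dist (mu_ n) mu <= delta%:E by near: n; exact: near_tv_dist.
have An : (fine (mu (A eps n)) <= eta)%R by near: n; exact: inmeas.
pose B := A eps n `|` L M.
have mB : measurable B by exact: measurableU.
have mSB : measurable (S `\` B) by exact: measurableD.
have mSIB : measurable (S `&` B) by exact: measurableI.
have SBM x : (S `\` B) x -> `|f x| <= M%:E.
  move=> [_ /not_orP[_ /negP]]; rewrite -ltNge => /ltW; exact.
have SBf x : (S `\` B) x -> f x - eps%:E <= f_ n x.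
  move=> [_ /not_orP[/negP + _]]; rewrite -ltNge => /ltW; exact.
have good := charge_ge_tv (mu_oo n) muoo (RNf_ n) RNf tvn mSB M0 (ltW eps0) SBM SBf.
have bad_ := Radon_Nikodym_lower (mu_oo n) (RNf_ n) mSIB K0.
have := Radon_Nikodym_abs_continuous muoo RNf mSIB (ltW M0) tM.
rewrite ler_norml => /andP[_ bad].
have tvS := tv_dist_measure (mu_oo n) muoo tvn mSIB.
have muSB : (fine (mu (S `&` B)) <= eta + fine (mu (L M)))%R.
  have := le_fine_measure muoo mSIB mB (@subIsetr _ _ _).
  have := fine_measureU2 muoo (mA eps n) (mL M).
  by rewrite -/B; lra.
have muL := fL M0 tM.
have epsm : (eps * fine (mu (S `\` B)) <= t)%R.
  have : (fine (mu (S `\` B)) <= m)%R by exact: le_fine_measure.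
  rewrite /eps mulrAC ler_pdivrMr ?ltr_wpDl// ler_pM2l//; lra.
have deltaE : ((M + eps) * delta = t)%R.
  by rewrite /delta mulrC divfK// gt_eqF// addr_gt0.
have etaE : (M * eta = t)%R by rewrite /eta mulrC divfK// gt_eqF.
have MmuSB : (M * fine (mu (S `&` B)) <= t + t)%R.
  have : (M * fine (mu (S `&` B)) <= M * (eta + fine (mu (L M))))%R.
    by rewrite ler_pM2l.
  by rewrite mulrDr; lra.
have KmuSB : (K * fine (mu_ n (S `&` B)) <= t + t + t)%R.
  have h1 : (K * fine (mu_ n (S `&` B)) <= K * (fine (mu (S `&` B)) + delta))%R.
    by rewrite ler_wpM2l.
  have h2 : (K * (fine (mu (S `&` B)) + delta) <=
             M * (fine (mu (S `&` B)) + delta))%R.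
    by rewrite ler_wpM2r// addr_ge0 ?fine_ge0// ltW.
  have h3 : (M * delta <= (M + eps) * delta)%R.
    by rewrite ler_wpM2r ?lerDl// ltW.
  by move: h1 h2 h3; rewrite mulrDr (mulrDr M); lra.
have tailn := tailsK n.
rewrite (chargeDI nu mS mB) (chargeDI (nu_ n) mS mB) !fineD ?fin_num_measure//.
rewrite deltaE in good.
have te0 : (e0 = 9 * t)%R by rewrite /t; field.
rewrite te0; lra.
Unshelve. all: by end_near. Qed.

Lemma liminf_inf_ge0P :
  0 <= limn_einf (fun n => ereal_inf [set nu_ n S - nu S | S in measurable])
  <-> uniform_minorant.
Proof.
have lbE e n : (0 - e)%:E <= ereal_inf [set nu_ n S - nu S | S in measurable]
    <-> forall S, measurable S -> (fine (nu S) - e <= fine (nu_ n S))%R.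
  split=> [lb S mS|lb].
    have : (0 - e)%:E <= nu_ n S - nu S.
      by apply: le_trans lb _; apply: ereal_inf_lbound; exists S.
    rewrite -(fineK (fin_num_measure nu _ mS)).
    rewrite -(fineK (fin_num_measure (nu_ n) _ mS)) -EFinB lee_fin; lra.
  apply: le_ereal_inf_tmp => _ [S mS <-].
  rewrite -(fineK (fin_num_measure nu _ mS)).
  rewrite -(fineK (fin_num_measure (nu_ n) _ mS)) -EFinB lee_fin.
  have := lb _ mS; lra.
split=> [/le_limf_einfP h e e0|h]; last apply/le_limf_einfP => e e0.
  by apply: filterS (h e e0) => n /lbE.
by apply: filterS (h e e0) => n /lbE.
Qed.

Lemma liminf_lower_tails_ge0P :
  0 <= limf_einf (fun K : R =>
      ereal_inf [set nu_ n [set s | f_ n s <= (- K)%:E] | n in [set: nat]])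
      (pinfty_nbhs R)
  <-> vanishing_lower_tails.
Proof.
have mS n K := measurable_Radon_Nikodym_le (RNf_ n) K.
have lbE e K : (0 - e)%:E <=
    ereal_inf [set nu_ n [set s | f_ n s <= (- K)%:E] | n in [set: nat]]
    <-> forall n, (- e <= fine (nu_ n [set s | (f_ n s <= (- K)%:E)%E]))%R.
  split=> [lb n|lb].
    rewrite -lee_fin fineK ?fin_num_measure// -[(- e)%R]add0r.
    by apply: le_trans lb _; apply: ereal_inf_lbound; exists n.
  apply: le_ereal_inf_tmp => _ [n _ <-].
  by rewrite add0r -(fineK (fin_num_measure (nu_ n) _ (mS n _))) lee_fin; exact: lb.
split=> [/le_limf_einfP h e e0|h]; last apply/le_limf_einfP => e e0.
  by apply: filterS (h e e0) => K /lbE.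
by apply: filterS (h e e0) => K /lbE.
Qed.

Lemma cvg_in_measureP :
  (forall eps : R, (0 < eps)%R ->
    mu [set s | f_ n s <= f s - eps%:E] @[n --> \oo] --> 0)
  <-> minorant_in_measure.
Proof.
have leE eps e n : mu (A eps n) <= e%:E <-> (fine (mu (A eps n)) <= e)%R.
  by rewrite -lee_fin fineK ?measure_fin_num//.
split=> [h eps e eps0 e0|h eps eps0].
  have : \forall n \near \oo, mu (A eps n) <= e%:E.
    exact: (nonneg_cvg0P _ (fun n => measure_ge0 mu (A eps n))).1 (h _ eps0) _ e0.
  by apply: filterS => n /leE.
apply: (nonneg_cvg0P _ (fun n => measure_ge0 mu (A eps n))).2 => e e0.
by apply: filterS (h eps e eps0 e0) => n /leE.
Qed.

End uniform_Fatou.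

(** * The criterion *)

Theorem corollary1p11 (d : measure_display) (T : measurableType d)
    (R : realType)
    (mu_ : nat -> {finite_measure set T -> \bar R})
    (mu : {measure set T -> \bar R})
    (nu_ : nat -> {charge set T -> \bar R})
    (nu : {charge set T -> \bar R})
    (nu_mu : nu `<< mu)
    (nu_mu_ : forall n, nu_ n `<< mu_ n)
    (f_ : nat -> T -> \bar R) (f : T -> \bar R)
    (f_RN : forall n, is_Radon_Nikodym (nu_ n) (mu_ n) (f_ n))
    (fRN : is_Radon_Nikodym nu mu f)
    (mu_cvg : tv_dist (mu_ n) mu @[n --> \oo] --> 0) :
  let cvg_in_measure :=
    forall eps : R, (0 < eps)%R ->
      mu [set s | f_ n s <= f s - eps%:E] @[n --> \oo] --> 0 in
  let subsequence :=
    exists2 n_ : nat -> nat, increasing_seq n_ &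
      {ae mu, forall s, f s <= limn_einf (fun k => f_ (n_ k) s)} in
  let cond_i := cvg_in_measure /\ subsequence in
  let cond_ii :=
    0 <= limf_einf (fun K : R =>
      ereal_inf [set nu_ n [set s | f_ n s <= (- K)%:E] | n in [set: nat]])
      (pinfty_nbhs R) in
  (0 <= limn_einf (fun n => ereal_inf [set nu_ n S - nu S | S in measurable])
     <-> cond_i /\ cond_ii)
  /\ (cvg_in_measure -> subsequence).
Proof.
move=> cvg_in_measure subsequence cond_i cond_ii.
have cvg_sub : cvg_in_measure -> subsequence.
  apply: ae_subsequence.
  - by move=> n; exact: is_Radon_Nikodym_measurable (f_RN n).
  - exact: is_Radon_Nikodym_measurable fRN.
  - by have := integrable_ae measurableT fRN.1; apply: filterS => x; exact.
have cvgP := cvg_in_measureP f_RN fRN mu_cvg.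
split=> //; split=> [/liminf_inf_ge0P unif|[[inmeas _] tails]].
  have inmeas := uniform_minorant_in_measure f_RN fRN mu_cvg unif.
  have cvg : cvg_in_measure by exact/cvgP.
  split; first by split=> //; exact: cvg_sub.
  apply/(liminf_lower_tails_ge0P f_RN).
  exact: uniform_minorant_lower_tails mu_cvg unif inmeas.
apply/liminf_inf_ge0P; apply: (lower_tails_uniform_minorant f_RN fRN mu_cvg).
  exact/cvgP.
exact/(liminf_lower_tails_ge0P f_RN).
Qed.
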